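(* Let a topological group $G$ be $\tau_g$-representable in locally compact spaces $Y$ and $X$, and let $b_X G$ be a graph compactification of $G$. Suppose that either (a) $f: Y\to X$ is a perfect onto $G$-map of $G$-spaces, or (b) $j: X\to Y$ is an embedding which is a $G$-map of $G$-spaces, and $j(X)$ is open in $Y$. Then $b_Y G$ is a graph compactification of $G$, $b_Y G\geq b_X G$, and $F^H|_{b_Y G}: b_Y G\to b_X G$ in case (a) (respectively $H_{\dashv}|_{b_Y G}: b_Y G\to b_X G=b_{j(X)}G$ in case (b)) is a map of compactifications.
   Context: All spaces are Tychonoff; maps are continuous; actions are effective. A $G$-map is an equivariant continuous map. An equiuniformity on a $G$-space $X$ is a uniformity $\mathcal U$ inducing the topology of $X$ such that every $g\in G$ is uniformly continuous and for every uniform cover $u\in\mathcal U$ there are a neighbourhood $O$ of $e\in G$ and $v\in\mathcal U$ such that $\{OV\mid V\in v\}$ refines $u$. $X$ is $G$-Tychonoff if it has an equiuniformity. A group $G$ is representable in $X$ if it is a subgroup of the homeomorphism group of $X$. The $g$-topology $\tau_g$ on $G$ has as subbase the sets $[K,O]=\{g\in G\mid gK\subset O\}$, $K$ closed, $O$ open in $X$, with $K$ compact or $X\setminus O$ compact. A topological group $(G,\tau)$ is $\tau_g$-representable in $X$ if $G$ is representable in $X$, $\tau=\tau_g$, and $X$ is a $G$-Tychonoff space under the natural action. $2^{X\times X}$ is the set of all closed subsets of $X\times X$ (including $\emptyset$) with the Fell topology $\tau_F$, whose subbase is all sets $\{F\mid F\cap W\neq\emptyset\}$, $W$ open, and $\{F\mid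 F\cap K=\emptyset\}$, $K$ compact; it is compact Hausdorff for locally compact $X$. Put $\imath_X^{\Gamma}:G\to 2^{X\times X}$, $\imath_X^{\Gamma}(g)=\{(x,gx)\mid x\in X\}$, and let $b_XG$ be the closure of $\imath_X^{\Gamma}(G)$ in $(2^{X\times X},\tau_F)$. If $\imath_X^{\Gamma}$ is a topological embedding, $b_XG$ (with $\imath_X^\Gamma$) is called a graph compactification of $G$. For compactifications $(b'G,b')$, $(bG,b)$ of $G$: $b'G\ge bG$ iff there is a continuous $\varphi:b'G\to bG$ with $\varphi\circ b'=b$; $\varphi$ is then the map of compactifications. For a perfect onto map $f:Y\to X$ of locally compact spaces, $F^H:2^{Y\times Y}\to 2^{X\times X}$, $F^H(R)=(f\times f)(R)$. For $j(X)$ open in $Y$, $H_{\dashv}:2^{Y\times Y}\to 2^{j(X)\times j(X)}$, $H_{\dashv}(R)=R\cap(j(X)\times j(X))$; $X$ is identified with $j(X)$. *)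

(* Defs.v *)
From HB Require Import structures.
From mathcomp Require Import all_boot all_order all_algebra.
From mathcomp Require Import boolp classical_sets functions reals.
From mathcomp Require Import topology normedtype.

Set Implicit Arguments.
Unset Strict Implicit.
Unset Printing Implicit Defensive.

Local Open Scope classical_set_scope.

HB.mixin Record Group_isTopological G & Topological G & Group G := {
  mulg_continuous : continuous (fun gh : G * G => (gh.1 * gh.2)%g);
  invg_continuous : continuous (fun g : G => g^-1%g)
}.

#[short(type="topologicalGroupType")]
HB.structure Definition TopologicalGroup :=
  {G of Topological G & Group G & Group_isTopological G}.

Definition tychonoff_space (T : topologicalType) : Prop :=
  hausdorff_space T /\ completely_regular_space T.

Lemma tychonoff_hausdorff (T : topologicalType) :
  tychonoff_space T -> hausdorff_space T.
Proof. by case. Qed.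

Definition topological_embedding (S T : topologicalType) (f : S -> T) : Prop :=
  [/\ continuous f, injective f &
      forall U : set S, open U -> exists2 V, open V & f @` U = V `&` range f].

Definition perfect_map (S T : topologicalType) (f : S -> T) : Prop :=
  [/\ continuous f, forall C : set S, closed C -> closed (f @` C) &
      forall t : T, compact (f @^-1` [set t])].

Section Actions.
Variables (G : topologicalGroupType) (X : topologicalType).
Variable act : G -> X -> X.

Definition is_action : Prop :=
  (forall x, act (1%g : G) x = x) /\
  (forall g h x, act (g * h)%g x = act g (act h x)).

Definition effective : Prop :=
  forall g, (forall x, act g x = x) -> g = (1%g : G).

(* G is a group of homeomorphisms of X: g |-> act g is an injective morphism,
   and the inverse of act g is act g^-1, so continuity of all the act g makes
   them homeomorphisms. *)
Definition representable : Prop :=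
  [/\ is_action, effective & forall g, continuous (act g)].

Definition G_space : Prop :=
  is_action /\ continuous (fun gx : G * X => act gx.1 gx.2).

Definition bracket (K O : set X) : set G := [set g | act g @` K `<=` O].

End Actions.

Definition g_topology (G : topologicalGroupType) (X : topologicalType)
  (act : G -> X -> X) : Type := G.

Section GTopology.
Variables (G : topologicalGroupType) (X : topologicalType).
Variable act : G -> X -> X.

HB.instance Definition _ := Choice.copy (g_topology act) G.
HB.instance Definition _ := isSubBaseTopological.Build (g_topology act)
  [set B : set (g_topology act) | exists K O : set X,
    [/\ closed K, open O, compact K \/ compact (~` O) & B = bracket act K O]] id.

End GTopology.

(* The covers belonging to the uniformity given by entourages: those refined by
   the cover of all sections of some entourage. *)
Definition uniform_cover (U : uniformType) (u : set (set U)) : Prop :=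
  exists2 E : set (U * U), entourage E &
    forall x, exists2 A, u A & xsection E x `<=` A.

Definition equiuniform (G : topologicalGroupType) (U : uniformType)
    (act : G -> U -> U) : Prop :=
  (forall g, unif_continuous (act g)) /\
  forall u : set (set U), uniform_cover u ->
    exists (O : set G) (v : set (set U)),
      [/\ nbhs (1%g : G) O, uniform_cover v &
          forall V, v V ->
            exists2 A, u A & [set act g x | g in O & x in V] `<=` A].

Definition G_tychonoff (G : topologicalGroupType) (X : topologicalType)
    (act : G -> X -> X) : Prop :=
  G_space act /\
  exists c : Uniform.axioms_ X, let UX := Uniform.Pack c in
    (forall x : X, @nbhs UX UX x = @nbhs X X x) /\ @equiuniform G UX act.

Definition tau_g_representable (G : topologicalGroupType) (X : topologicalType)
    (act : G -> X -> X) : Prop :=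
  [/\ representable act,
      forall U : set G, open U <-> @open (g_topology act) U &
      G_tychonoff act].

Lemma tau_g_continuous (G : topologicalGroupType) (X : topologicalType)
    (act : G -> X -> X) :
  tau_g_representable act -> forall g, continuous (act g).
Proof. by case=> -[]. Qed.

Definition equivariant (G S T : Type) (aS : G -> S -> S) (aT : G -> T -> T)
    (f : S -> T) : Prop :=
  forall g x, f (aS g x) = aT g (f x).

Definition G_map (G : Type) (S T : topologicalType)
    (aS : G -> S -> S) (aT : G -> T -> T) (f : S -> T) : Prop :=
  continuous f /\ equivariant aS aT f.

Definition hyperspace (T : topologicalType) : Type := {F : set T | closed F}.

Section Fell.
Variable T : topologicalType.

HB.instance Definition _ := gen_eqMixin (hyperspace T).
HB.instance Definition _ := gen_choiceMixin (hyperspace T).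
HB.instance Definition _ := isSubBaseTopological.Build (hyperspace T)
  ([set [set F : hyperspace T | sval F `&` W !=set0] | W in @open T] `|`
   [set [set F : hyperspace T | sval F `&` K = set0] | K in @compact T]) id.

End Fell.

Section Graphs.
Variables (G : topologicalGroupType) (X : topologicalType).
Variable act : G -> X -> X.
Hypothesis hX : hausdorff_space X.
Hypothesis cact : forall g, continuous (act g).

Lemma closed_graph g : closed [set (x, act g x) | x in [set: X]].
Proof.
move=> [x y] clxy; exists x => //; congr (_, _).
apply: hX => A B Ax By.
have nAB : nbhs (x, y) ((act g @^-1` A) `*` B).
  by exists (act g @^-1` A, B) => //; split=> //; exact: cact.
by have [_ [[z _ <-] [/= Az Bz]]] := clxy _ nAB; exists (act g z).
Qed.

Definition graph g : hyperspace (X * X)%type := exist _ _ (@closed_graph g).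

Definition graph_closure : set (hyperspace (X * X)%type) :=
  closure (range graph).

Lemma graph_in_closure g : graph g \in graph_closure.
Proof. by apply/mem_set/subset_closure; exists g. Qed.

Definition graph_corestr g : graph_closure :=
  exist (fun F => F \in graph_closure) _ (graph_in_closure g).

Definition graph_compactification : Prop := topological_embedding graph.

End Graphs.

Definition compactification_map (G K' K : topologicalType)
    (b' : G -> K') (b : G -> K) (phi : K' -> K) : Prop :=
  continuous phi /\ forall g, phi (b' g) = b g.

Definition compactification_ge (G K' K : topologicalType)
    (b' : G -> K') (b : G -> K) : Prop :=
  exists phi, compactification_map b' b phi.

Lemma continuous_square (S T : topologicalType) (f : S -> T) :
  continuous f -> continuous (fun p : S * S => (f p.1, f p.2)).
Proof.
move=> cf [x y] U [[A B] [/= Ax By] AB].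
exists (f @^-1` A, f @^-1` B) => /=; first by split; exact: cf.
by move=> [u v] [/= Au Bv]; exact: AB.
Qed.

Section PerfectImage.
Variables (Y X : topologicalType) (f : Y -> X).
Hypothesis pf : perfect_map f.

Lemma perfect_tube (Z : topologicalType) (z : Z) (x : X) (W : set (Z * Y)) :
  (forall y, f y = x -> nbhs (z, y) W) ->
  nbhs (z, x) [set p | forall y, f y = p.2 -> W (p.1, y)].
Proof.
case: pf => _ clf /(_ x) /compact_near_coveringP kx nW.
pose F := filter_from (nbhs z) (fun A : set Z => [set U : set Z | U `<=` A]).
have FF : Filter F.
  apply: filter_from_filter; first by exists setT; exact: filterT.
  move=> A B zA zB; exists (A `&` B); first exact: filterI.
  by move=> U UAB; split=> u /UAB [].
pose P (U : set Z) (y : Y) := nbhs y [set v | forall u, U u -> W (u, v)].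
have [|A zA AP] := kx (set Z) F P FF.
  move=> y /nW [[A B] [/= zA yB] AB].
  exists (B°, [set U : set Z | U `<=` A]) => /=.
    by split; [exact: nbhs_interior | exists A].
  move=> [v U] [/= Bv UA]; apply: filterS Bv => w Bw u Uu.
  by apply: AB; split => //=; exact: UA.
set V := [set v | forall u, A u -> W (u, v)].
exists (A, ~` (f @` (~` V°))) => /=.
  split=> //; apply: open_nbhs_nbhs; split.
    by rewrite openC; apply: clf; exact/open_closedC/open_interior.
  by move=> [y nVy fy]; apply: nVy; exact: (AP A).
move=> [u w] /= [Au nw] y fy; apply: contrapT => nW'.
apply: nw; exists y => // /interior_subset Vy.
exact/nW'/Vy.
Qed.

Lemma closed_perfect_image (R : set (Y * Y)) :
  closed R -> closed [set (f r.1, f r.2) | r in R].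
Proof.
move=> clR; rewrite -openC openE => -[a b] /= nab.
have oR : open (~` R) by rewrite openC.
have H1 y : f y = a -> nbhs (b, y) [set q | forall y', f y' = q.1 -> ~ R (q.2, y')].
  move=> ya.
  have [|[A B] [/= yA bB] AB] := @perfect_tube Y y b (~` R).
    move=> y' y'b; apply: open_nbhs_nbhs; split=> // Ryy'.
    by apply: nab; exists (y, y') => //=; rewrite ya y'b.
  by exists (B, A) => // -[z u] [/= Bz Au] y'; exact: (AB (u, z)).
have [[A B] [/= bA aB] AB] := perfect_tube H1.
exists (B, A) => // -[u v] [/= Bu Av] [[y y'] Ryy' [fy fy']].
exact: (AB (v, u) _ y fy y' fy').
Qed.

Definition FH (R : hyperspace (Y * Y)%type) : hyperspace (X * X)%type :=
  exist _ _ (closed_perfect_image (svalP R)).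

End PerfectImage.

Section RangeSquare.
Variables (X Y : topologicalType) (j : X -> Y).

Lemma closed_trace (R : set (Y * Y)) : closed R ->
  closed [set p : range j * range j | R (set_val p.1, set_val p.2)].
Proof.
apply: preimage_closed => p _.
exact/continuous_square/initial_continuous.
Qed.

(* R `&` (j(X) `*` j(X)), as a subset of the square of the space j(X) *)
Definition Hdash (R : hyperspace (Y * Y)%type) :
    hyperspace (range j * range j)%type :=
  exist _ _ (closed_trace (svalP R)).

Lemma corestr_subproof x : j x \in range j.
Proof. exact/mem_set/imageT. Qed.

Definition corestr x : range j :=
  exist (fun y => y \in range j) _ (corestr_subproof x).

Hypothesis cj : continuous j.

Lemma corestr_continuous : continuous corestr.
Proof. by apply/continuousP => _ [V oV <-]; move/continuousP: cj; exact. Qed.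

Lemma closed_transport (R : set (range j * range j)) : closed R ->
  closed [set p : X * X | R (corestr p.1, corestr p.2)].
Proof.
apply: preimage_closed => p _.
exact/continuous_square/corestr_continuous.
Qed.

(* For an embedding j, corestr is a homeomorphism of X onto j(X); transport is
   the resulting identification of the hyperspaces of their squares. *)
Definition transport (R : hyperspace (range j * range j)%type) :
    hyperspace (X * X)%type :=
  exist _ _ (closed_transport (svalP R)).

End RangeSquare.

Section RangeAction.
Variables (G : topologicalGroupType) (X Y : topologicalType).
Variables (aX : G -> X -> X) (aY : G -> Y -> Y) (j : X -> Y).
Hypothesis ej : equivariant aX aY j.

Lemma range_act_subproof g (y : range j) : aY g (set_val y) \in range j.
Proof.
have [x _ jx] := set_valP y; apply/mem_set.
by exists (aX g x) => //; rewrite ej jx.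
Qed.

Definition range_act g (y : range j) : range j :=
  exist (fun y => y \in range j) _ (range_act_subproof g y).

Hypothesis caY : forall g, continuous (aY g).

Lemma range_act_continuous g : continuous (range_act g).
Proof.
apply/continuousP => _ [V oV <-].
have /continuousP : continuous (aY g \o (set_val : range j -> Y)).
  by move=> y; apply: continuous_comp; [exact: initial_continuous|exact: caY].
exact.
Qed.

End RangeAction.

Lemma hausdorff_range (X Y : topologicalType) (j : X -> Y) :
  hausdorff_space Y -> hausdorff_space (range j).
Proof.
move=> hY p q clpq; apply: val_inj; apply: hY => A B Ap Bq.
have [r [Ar Br]] := clpq (set_val @^-1` A) (set_val @^-1` B)
  (initial_continuous Ap) (initial_continuous Bq).
by exists (set_val r).
Qed.

(* Main.v *)
(* The graph map of a jointly continuous action is always continuous for the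
   Fell topology.  In both cases there is a continuous map of hyperspaces
   carrying the graph of g on Y to the graph of g on X: the image under f x f,
   continuous because perfect maps pull compact sets back to compact sets, and
   the preimage under j x j, continuous because j is open.  Thus the graph map of
   X factors through that of Y, which makes the latter an embedding, and the
   hyperspace map restricts to the closures by continuity. *)

Require Import Defs.
From HB Require Import structures.
From mathcomp Require Import all_boot all_order all_algebra.
From mathcomp Require Import boolp classical_sets functions reals.
From mathcomp Require Import topology normedtype.

Set Implicit Arguments.
Unset Strict Implicit.
Unset Printing Implicit Defensive.

Local Open Scope classical_set_scope.

(** * The Fell topology: subbasic sets and a continuity test *)

Lemma hyperspace_eq (T : topologicalType) (E F : hyperspace T) :
  sval E = sval F -> E = F.
Proof. by case: E F => [E cE] [F cF] /= EF; exact: eq_exist. Qed.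

Lemma fell_hit_open (T : topologicalType) (W : set T) :
  open W -> open [set F : hyperspace T | sval F `&` W !=set0].
Proof.
move=> oW; exists [set [set F : hyperspace T | sval F `&` W !=set0]].
  by move=> _ ->; apply: finI_from1; left; exists W.
exact: bigcup_set1.
Qed.

Lemma fell_miss_open (T : topologicalType) (K : set T) :
  compact K -> open [set F : hyperspace T | sval F `&` K = set0].
Proof.
move=> cK; exists [set [set F : hyperspace T | sval F `&` K = set0]].
  by move=> _ ->; apply: finI_from1; right; exists K.
exact: bigcup_set1.
Qed.

(** Preimages commute with unions and finite intersections, so the subbasic hit and miss sets
    suffice. *)
Lemma fell_continuous (Z T : topologicalType) (phi : Z -> hyperspace T) :
  (forall W, open W -> open [set z | sval (phi z) `&` W !=set0]) ->
  (forall K, compact K -> open [set z | sval (phi z) `&` K = set0]) ->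
  continuous phi.
Proof.
move=> hit miss; apply/continuousP => _ [D sD <-].
rewrite preimage_bigcup; apply: bigcup_open => A /sD [E sE <-].
rewrite preimage_bigcap openE => z Ez; apply: filter_bigI => B EB.
apply: open_nbhs_nbhs; split; last exact: Ez.
by case: (set_mem (sE _ EB)) => -[C hC <-]; [exact: hit|exact: miss].
Qed.

(** * Closures and embeddings under continuous maps *)

Lemma image_closure_subset (S T : topologicalType) (phi : S -> T) (A : set S) :
  continuous phi -> phi @` closure A `<=` closure (phi @` A).
Proof.
move=> cphi _ [s clAs <-] B /cphi /clAs [a [Aa Ba]].
by exists (phi a); split=> //; exists a.
Qed.

(** Used to identify the closure of the graphs over j(X) with the closure of the graphs over X. *)
Lemma image_closure_cancel (S T : topologicalType) (phi : S -> T) (psi : T -> S)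
    (A : set S) :
  continuous phi -> continuous psi -> cancel phi psi -> cancel psi phi ->
  phi @` closure A = closure (phi @` A).
Proof.
move=> cphi cpsi phiK psiK.
apply/seteqP; split; first exact: image_closure_subset.
move=> t clt; exists (psi t) => // B /cpsi /clt [_ [[a Aa <-] Ba]].
by exists a; split=> //; rewrite -(phiK a).
Qed.

Lemma embedding_of_factor (S T Z : topologicalType) (f : S -> T) (phi : T -> Z) :
  continuous f -> continuous phi -> topological_embedding (phi \o f) ->
  topological_embedding f.
Proof.
move=> cf /continuousP cphi [_ inj opn]; split=> //.
  by move=> x y fxy; apply: inj; rewrite /= fxy.
move=> U /opn [V oV UV]; exists (phi @^-1` V); first exact: cphi.
apply/seteqP; split=> [_ [x Ux <-]|t [Vt [x _ fx]]].
  split; last by exists x.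
  have : ((phi \o f) @` U) (phi (f x)) by exists x.
  by rewrite UV => -[].
have : ((phi \o f) @` U) (phi (f x)).
  by rewrite UV; split; [rewrite /= fx|exists x].
by move=> [y Uy /inj yx]; rewrite -fx -yx; exists y.
Qed.

(** * Continuity of preimage maps, graph maps and perfect image maps *)

Lemma square_open (S T : topologicalType) (h : S -> T) :
  (forall U, open U -> open (h @` U)) ->
  forall W, open W -> open ((fun p : S * S => (h p.1, h p.2)) @` W).
Proof.
move=> oh W oW; rewrite openE => _ [[a b] Wab <-].
have [[A B] [/= nA nB] AB] : nbhs (a, b) W by exact: open_nbhs_nbhs.
have nh s C : nbhs s C -> nbhs (h s) (h @` C).
  move=> nC; apply: (@filterS _ _ _ (h @` C°)).
    by apply: image_subset; exact: interior_subset.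
  apply: open_nbhs_nbhs; split; first exact/oh/open_interior.
  by exists s.
exists (h @` A, h @` B); first by split; exact: nh.
move=> [_ _] [/= [a' Aa' <-] [b' Bb' <-]].
by exists (a', b') => //; exact: AB.
Qed.

(** The set [h @^-1] R[meets]W[iff]R[meets]h @[W]. Openness of [h] settles the hit sets, and
    compactness of continuous images settles the miss sets. *)
Lemma fell_preimage_continuous (S T : topologicalType) (h : S -> T)
    (phi : hyperspace T -> hyperspace S) :
  continuous h -> (forall U, open U -> open (h @` U)) ->
  (forall R, sval (phi R) = h @^-1` sval R) -> continuous phi.
Proof.
move=> ch oh phiE; apply: fell_continuous => [W oW|K cK].
  rewrite (_ : mkset _ = [set R | sval R `&` h @` W !=set0]).
    exact/fell_hit_open/oh.
  apply/seteqP; split=> R /=; rewrite phiE.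
    by move=> [x [Rx Wx]]; exists (h x); split=> //; exists x.
  by move=> [t [Rt [x Wx xE]]]; exists x; rewrite /= xE.
rewrite (_ : mkset _ = [set R | sval R `&` h @` K = set0]).
  apply/fell_miss_open/continuous_compact => //.
  exact: continuous_subspaceT.
apply/seteqP; split=> R /=; rewrite phiE -!subset0 => RK.
  by move=> t [Rt [x Kx xE]]; apply: (RK x); rewrite /= xE.
by move=> x [Rx Kx]; apply: (RK (h x)); split=> //; exists x.
Qed.

Lemma perfect_preimage_compact (S T : topologicalType) (f : S -> T) (K : set T) :
  perfect_map f -> compact K -> compact (f @^-1` K).
Proof.
move=> [_ clf fib] /compact_near_coveringP cK.
apply/compact_near_coveringP => I F P FF nP.
(* Compactness of [K] is applied to the property that [P i] holds on the whole fiber over [t]. *)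
apply: filterS (cK I F (fun i t => forall s, f s = t -> P i s) FF _).
  by move=> i Ki s Ks; exact: (Ki (f s)).
(* Covering the fiber along the filter of [F]-small sets yields a single set of
   [F] that works on a whole neighbourhood of the fiber. *)
move=> t Kt; pose F' := filter_from F (fun A => [set U : set I | U `<=` A]).
have FF' : Filter F'.
  apply: filter_from_filter; first by exists setT; exact: filterT.
  move=> A B FA FB; exists (A `&` B); first exact: filterI.
  by move=> U UAB; split=> u /UAB [].
have /compact_near_coveringP fibt := fib t.
pose Q (U : set I) (s : S) := nbhs s [set s' | forall u, U u -> P u s'].
have [|A FA AQ] := fibt _ F' Q FF'.
  move=> s fs; have [|[B A] [/= sB FA] AB] := nP s; first by rewrite /= fs.
  exists (B°, [set U | U `<=` A]) => /=.
    by split; [exact: nbhs_interior|exists A].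
  move=> [s' U] [/= Bs' UA]; apply: filterS Bs' => r Br u Uu.
  by apply: (AB (r, u)); split=> //=; exact: UA.
set V := [set s | forall u, A u -> P u s].
exists (~` (f @` (~` V°)), A) => /=.
  split=> //; apply: open_nbhs_nbhs; split.
    by rewrite openC; apply: clf; exact/open_closedC/open_interior.
  by move=> [s nVs fs]; apply: nVs; exact: (AQ A).
move=> [t' i] [/= nt' Ai] s fs; apply: contrapT => nP'.
by apply: nt'; exists s => // /interior_subset /(_ i Ai).
Qed.

(** Hit sets need joint continuity at one point of the graph only. For a miss set, each point of [K]
    is off the graph of [g], stays off nearby by separation and joint continuity, and compactness of
    [K] makes the neighbourhood of [g] uniform. *)
Lemma graph_continuous (G : topologicalGroupType) (X : topologicalType)
    (act : G -> X -> X) (hX : hausdorff_space X)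
    (cact : forall g, continuous (act g)) :
  G_space act -> continuous (graph hX cact).
Proof.
move=> [_ jact]; apply: fell_continuous => [W oW|K /compact_near_coveringP cK].
  rewrite openE => g [_ [[x _ <-] Wx]].
  have [[A B] [/= nA nB] AB] : nbhs (x, act g x) W by exact: open_nbhs_nbhs.
  have [[C D] [/= nC nD] CD] := jact (g, x) B nB.
  apply: filterS nC => g' Cg'; exists (x, act g' x); split; first by exists x.
  apply: AB; split=> /=; first exact: nbhs_singleton.
  by apply: (CD (g', x)); split=> //=; exact: nbhs_singleton.
rewrite openE => g; rewrite /= -subset0 => gK.
have := cK G (nbhs g) (fun g' p => act g' p.1 <> p.2) _.
have H : forall p, K p ->
    \forall p' \near p & g' \near nbhs g, act g' p'.1 <> p'.2.
  move=> [x y] Kxy.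
  have gxy : act g x != y.
    apply/eqP => gxy; apply: (gK (x, y)).
    by split=> //; exists x => //; rewrite gxy.
  move: hX; rewrite open_hausdorff => /(_ _ _ gxy).
  move=> [[A B] /= [/set_mem Ax /set_mem By] [oA oB /eqP AB]].
  have [[C D] [/= nC nD] CD] := jact (g, x) A (open_nbhs_nbhs (conj oA Ax)).
  exists (D `*` B, C) => /=.
    split=> //; exists (D, B) => //; split=> //; exact: open_nbhs_nbhs.
  move=> [[x' y'] g'] [/= [Dx By'] Cg'] gE.
  suff : (A `&` B) y' by rewrite AB.
  by split=> //; rewrite -gE; exact: (CD (g', x')).
move=> /(_ _ H); apply: filterS => g' Kg'.
by rewrite /= -subset0 => _ [[x _ <-] /Kg']; apply.
Qed.

(** The image of [R] under [ff] meets a set iff [R] meets its preimage. Since [ff] is itself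
    perfect, preimages of compact sets are compact. *)
Lemma FH_continuous (Y X : topologicalType) (f : Y -> X) (pf : perfect_map f) :
  continuous (FH pf).
Proof.
have [cf clf fib] := pf; pose ff (p : Y * Y) := (f p.1, f p.2).
have cff : continuous ff by exact: continuous_square.
have pff : perfect_map ff.
  split=> //; first exact: closed_perfect_image.
  move=> [x x']; rewrite (_ : _ @^-1` _ = f @^-1` [set x] `*` f @^-1` [set x']).
    exact: compact_setX.
  by apply/seteqP; split=> -[y y'] /=; [move=> [-> ->]|move=> [/= <- <-]].
apply: fell_continuous => [W oW|K cK].
  rewrite (_ : mkset _ = [set R | sval R `&` ff @^-1` W !=set0]).
    by apply: fell_hit_open; move/continuousP: cff; exact.
  apply/seteqP; split=> R /=; first by move=> [_ [[r Rr <-] Wr]]; exists r.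
  by move=> [r [Rr Wr]]; exists (ff r); split=> //; exists r.
rewrite (_ : mkset _ = [set R | sval R `&` ff @^-1` K = set0]).
  exact/fell_miss_open/perfect_preimage_compact.
apply/seteqP; split=> R /=; rewrite -!subset0 => RK.
  by move=> r [Rr Kr]; apply: (RK (ff r)); split=> //; exists r.
by move=> _ [[r Rr <-] Kr]; exact: (RK r).
Qed.

(** * Embeddings and their corestriction to the image *)

Lemma embedding_open_map (S T : topologicalType) (j : S -> T) :
  topological_embedding j -> open (range j) ->
  forall U, open U -> open (j @` U).
Proof. by move=> [_ _ oj] or U /oj [V oV ->]; exact: openI. Qed.

Lemma corestr_open (S T : topologicalType) (j : S -> T) :
  topological_embedding j -> forall U, open U -> open (corestr j @` U).
Proof.
(* Open sets of [range j] are traces of open sets of [T], so the [V] given by the embedding is the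
   witness. *)
move=> [_ _ oj] U /oj [V oV UV]; exists V => //.
apply/seteqP; split=> [y Vy|_ [x Ux <-]]; last first.
  have : (j @` U) (j x) by exists x.
  by rewrite UV => -[].
have : (V `&` range j) (set_val y) by split=> //; exact: set_valP.
by rewrite -UV => -[x Ux xy]; exists x => //; exact: val_inj.
Qed.

Lemma corestr_bij (S T : topologicalType) (j : S -> T) :
  injective j -> exists2 k, cancel (corestr j) k & cancel k (corestr j).
Proof.
move=> inj.
have H (y : range j) : exists x, corestr j x = y.
  by have [x _ xy] := set_valP y; exists x; exact: val_inj.
exists (fun y => projT1 (cid (H y))) => [x|y]; last by case: cid.
by case: cid => x' /= /(congr1 set_val) /inj.
Qed.

(** * The argument common to both cases, and graphs in case (a) *)

Lemma compactification_factor (G : topologicalGroupType) (X Y : topologicalType)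
    (aX : G -> X -> X) (aY : G -> Y -> Y)
    (hX : hausdorff_space X) (hY : hausdorff_space Y)
    (cX : forall g, continuous (aX g)) (cY : forall g, continuous (aY g))
    (Phi : hyperspace (Y * Y)%type -> hyperspace (X * X)%type) :
  let bX := graph_corestr hX cX in
  let bY := graph_corestr hY cY in
  G_space aY -> graph_compactification hX cX ->
  continuous Phi -> (forall g, Phi (graph hY cY g) = graph hX cX g) ->
  [/\ graph_compactification hY cY,
      compactification_ge bY bX &
      exists phi : graph_closure hY cY -> graph_closure hX cX,
        compactification_map bY bX phi /\
        forall R, set_val (phi R) = Phi (set_val R)].
Proof.
move=> bX bY GY emb cPhi PhiE.
have Phicl (R : graph_closure hY cY) : Phi (set_val R) \in graph_closure hX cX.
  (* The graphs over [X] are the [Phi]-images of those over [Y], so continuity sends closure into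
     closure. *)
  apply/mem_set; rewrite /graph_closure (_ : range _ = Phi @` range (graph hY cY)).
    by apply: image_closure_subset => //; exists (set_val R) => //; exact: set_valP.
  by rewrite image_comp; apply: eq_imagel => g _; rewrite /= PhiE.
pose phi (R : graph_closure hY cY) : graph_closure hX cX :=
  exist (fun F => F \in graph_closure hX cX) _ (Phicl R).
have phimap : compactification_map bY bX phi.
  split; last by move=> g; apply: val_inj; exact: PhiE.
  apply/continuousP => _ [V oV <-].
  (* The target carries the subspace topology, so continuity may be tested after inclusion into the
     hyperspace. *)
  have /continuousP : continuous (Phi \o (set_val : graph_closure hY cY -> _)).
    by move=> R; apply: continuous_comp; [exact: initial_continuous|exact: cPhi].
  exact.
split; [|by exists phi|by exists phi].
apply: (embedding_of_factor (phi := Phi)) => //; first exact: graph_continuous.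
by rewrite (_ : Phi \o _ = graph hX cX) //; apply: funext.
Qed.

Lemma FH_graph (G : topologicalGroupType) (X Y : topologicalType)
    (aX : G -> X -> X) (aY : G -> Y -> Y)
    (hX : hausdorff_space X) (hY : hausdorff_space Y)
    (cX : forall g, continuous (aX g)) (cY : forall g, continuous (aY g))
    (f : Y -> X) (pf : perfect_map f) :
  range f = [set: X] -> equivariant aY aX f ->
  forall g, FH pf (graph hY cY g) = graph hX cX g.
Proof.
move=> surj ef g; apply: hyperspace_eq => /=; apply/seteqP; split.
  by move=> _ [_ [y _ <-] <-]; exists (f y) => //=; rewrite ef.
move=> _ [x _ <-]; have [y _ <-] : range f x by rewrite surj.
by exists (y, aY g y); [exists y|rewrite /= ef].
Qed.

(** * Case (b): restriction to j(X) and its identification with X *)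

Lemma transport_Hdash_continuous (X Y : topologicalType) (j : X -> Y)
    (cj : continuous j) :
  topological_embedding j -> open (range j) ->
  continuous (transport cj \o Hdash j).
Proof.
move=> ej oj.
(* Restricting to j(X) and then transporting to X amounts to the preimage under the square of [j],
   an open map. *)
apply: (@fell_preimage_continuous _ _ (fun p : X * X => (j p.1, j p.2))) => //.
  exact: continuous_square.
exact/square_open/embedding_open_map.
Qed.

Lemma transport_continuous (X Y : topologicalType) (j : X -> Y)
    (cj : continuous j) :
  topological_embedding j -> continuous (transport cj).
Proof.
move=> ej.
apply: (@fell_preimage_continuous _ _
  (fun p : X * X => (corestr j p.1, corestr j p.2))) => //.
  exact/continuous_square/corestr_continuous.
exact/square_open/corestr_open.
Qed.

(** The inverse of [corestr j] is again continuous and open, and preimage under its square inverts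
    [transport]. *)
Lemma transport_inverse (X Y : topologicalType) (j : X -> Y) (cj : continuous j) :
  topological_embedding j ->
  exists psi, [/\ continuous psi, cancel (transport cj) psi &
                  cancel psi (transport cj)].
Proof.
move=> ej; have [_ inj _] := ej; have [k jk kj] := corestr_bij inj.
pose kk (p : range j * range j) := (k p.1, k p.2).
(* Exchanging images and preimages turns openness of [corestr j] into continuity of [k], and
   continuity into openness. *)
have preim (U : set X) : k @^-1` U = corestr j @` U.
  apply/seteqP; split=> [y Uy|_ [x Ux <-]]; last by rewrite /= jk.
  by exists (k y).
have im (U : set (range j)) : k @` U = corestr j @^-1` U.
  apply/seteqP; split=> [_ [y Uy <-]|x Ux]; first by rewrite /= kj.
  by exists (corestr j x).
have ck : continuous k.
  by apply/continuousP => U oU; rewrite preim; exact: corestr_open.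
have ok U : open U -> open (k @` U).
  by move=> oU; rewrite im; have /continuousP := corestr_continuous cj; exact.
have ckk : continuous kk by exact: continuous_square.
have clk (R : hyperspace (X * X)%type) : closed (kk @^-1` sval R).
  by apply: preimage_closed (svalP R) => p _; exact: ckk.
pose psi (R : hyperspace (X * X)%type) : hyperspace (range j * range j)%type :=
  exist _ _ (clk R).
exists psi; split.
- exact: (@fell_preimage_continuous _ _ kk) (square_open ok) _.
- move=> R; apply: hyperspace_eq; apply/seteqP; split=> -[p q] /=;
  by rewrite /kk /= !kj.
- move=> R; apply: hyperspace_eq; apply/seteqP; split=> -[p q] /=;
  by rewrite /kk /= !jk.
Qed.

Lemma transport_graph (G : topologicalGroupType) (X Y : topologicalType)
    (aX : G -> X -> X) (aY : G -> Y -> Y)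
    (hX : hausdorff_space X) (hY : hausdorff_space Y)
    (cX : forall g, continuous (aX g)) (cY : forall g, continuous (aY g))
    (j : X -> Y) (cj : continuous j) (ej : equivariant aX aY j) :
  injective j ->
  forall g, transport cj (graph (hausdorff_range (j := j) hY)
      (range_act_continuous (ej := ej) cY) g) = graph hX cX g.
Proof.
move=> inj g; apply: hyperspace_eq; apply/seteqP; split=> -[x x'] /=.
  move=> [y _ [yx yx']]; exists x => //; congr (_, _); apply: inj.
  by rewrite ej -yx' yx.
move=> [_ _ [-> <-]]; exists (corestr j x) => //; congr (_, _).
by apply: val_inj => /=; rewrite ej.
Qed.

Lemma Hdash_graph (G : topologicalGroupType) (X Y : topologicalType)
    (aX : G -> X -> X) (aY : G -> Y -> Y) (hY : hausdorff_space Y)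
    (cY : forall g, continuous (aY g)) (j : X -> Y) (ej : equivariant aX aY j) :
  forall g, Hdash j (graph hY cY g) =
    graph (hausdorff_range (j := j) hY) (range_act_continuous (ej := ej) cY) g.
Proof.
move=> g; apply: hyperspace_eq; apply/seteqP; split=> -[y y'] /=.
  move=> [_ _ [-> yy']]; exists y => //; congr (_, _); exact: val_inj.
by move=> [_ _ [-> <-]]; exists (set_val y).
Qed.

(** * Assembly of the two cases *)

Theorem theorem3p21 (G : topologicalGroupType) (X Y : topologicalType)
    (aX : G -> X -> X) (aY : G -> Y -> Y)
    (TG : tychonoff_space G) (TX : tychonoff_space X) (TY : tychonoff_space Y)
    (lcX : locally_compact [set: X]) (lcY : locally_compact [set: Y])
    (rX : tau_g_representable aX) (rY : tau_g_representable aY) :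
  let hX := tychonoff_hausdorff TX in
  let hY := tychonoff_hausdorff TY in
  let cX := tau_g_continuous rX in
  let cY := tau_g_continuous rY in
  let bX := graph_corestr hX cX in
  let bY := graph_corestr hY cY in
  graph_compactification hX cX ->
  (forall (f : Y -> X) (pf : perfect_map f),
     range f = [set: X] -> G_map aY aX f ->
     [/\ graph_compactification hY cY,
         compactification_ge bY bX &
         exists phi : graph_closure hY cY -> graph_closure hX cX,
           compactification_map bY bX phi /\
           forall R, set_val (phi R) = FH pf (set_val R)]) /\
  (forall (j : X -> Y) (mj : G_map aX aY j),
     topological_embedding j -> open (range j) ->
     let cj := proj1 mj in
     let hjX := hausdorff_range (j := j) hY in
     let cjX := range_act_continuous (ej := proj2 mj) cY in
     [/\ graph_compactification hY cY,
         compactification_ge bY bX,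
         transport cj @` graph_closure hjX cjX = graph_closure hX cX,
         forall g, transport cj (graph hjX cjX g) = graph hX cX g &
         exists phi : graph_closure hY cY -> graph_closure hX cX,
           compactification_map bY bX phi /\
           forall R, set_val (phi R) = transport cj (Hdash j (set_val R))]).
Proof.
move=> hX hY cX cY bX bY emb; have [_ _ [GY _]] := rY.
split=> [f pf surj [_ ef]|j mj ej oj cj hjX cjX].
  apply: compactification_factor => //; first exact: FH_continuous.
  exact: FH_graph.
have [_ inj _] := ej.
have tg g : transport cj (graph hjX cjX g) = graph hX cX g.
  exact: transport_graph.
have [||embY geY phiY] := @compactification_factor _ _ _ _ _ hX hY cX cY
  (transport cj \o Hdash j) GY emb.
- exact: transport_Hdash_continuous.
- by move=> g; rewrite /= (Hdash_graph _ _ (proj2 mj)); exact: tg.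
(* What remains is the equality of closures: [transport cj] is a homeomorphism matching the two
   families of graphs. *)
split=> //; have [psi [cpsi tK psiK]] := transport_inverse cj ej.
rewrite /graph_closure (image_closure_cancel _ _ cpsi tK psiK).
  by rewrite image_comp; congr closure; apply: eq_imagel => g _; exact: tg.
exact: transport_continuous.
Qed.
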